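(* Let $R$ be the complex $n$-dimensional Leibniz algebra with basis $\{x_1,\dots,x_n\}$ and multiplication $$[x_i,x_1]=x_{i+1}\ (2\le i\le n-1),\quad [x_1,x_2]=x_1,\quad [x_i,x_2]=(i-2)x_i\ (3\le i\le n),\quad [x_i,x_3]=-x_{i+1}\ (2\le i\le n-1),$$ all other products of basis elements being zero. Then the algebra $R$ is rigid.
   Context: A Leibniz algebra over $\mathbb{C}$ is a vector space $L$ with a bilinear bracket satisfying $[x,[y,z]]=[[x,y],z]-[[x,z],y]$ for all $x,y,z\in L$. $Leib_n$ denotes the variety of all $n$-dimensional complex Leibniz algebra laws $\lambda$; the group $GL_n(\mathbb{C})$ acts on it by $(g*\lambda)(x,y)=g(\lambda(g^{-1}(x),g^{-1}(y)))$, and the orbits are the isomorphism classes. An $n$-dimensional Leibniz algebra is called rigid if its orbit is open in $Leib_n$.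
   Formalization: The theorem assumes n ≥ 4: for n ≤ 2 the element x_3 in the table does not exist, and for n = 3 the algebra is not rigid, since with e = x_1+x_3 the product [e,x_2] = e deforms to [e,x_2] = a e, giving non-isomorphic Leibniz algebras for a near 1. *)

(* Defs.v *)
From mathcomp Require Import all_boot all_algebra.
From mathcomp Require Import classical_sets reals.
From mathcomp Require Import complex mpoly.

Set Implicit Arguments.
Unset Strict Implicit.
Unset Printing Implicit Defensive.

Import GRing.Theory.

Local Open Scope classical_set_scope.
Local Open Scope ring_scope.

(* The field of complex numbers is R[i], for R : realType. *)

(* A bilinear law on C^n is given by its structure constants, so that the     *)
(* laws are the points of the affine space C^(n^3):                           *)
(*   [e_i, e_j] = \sum_k c (i, j, k) e_k.                                     *)
Definition law (R : realType) (n : nat) : Type :=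
  {ffun 'I_n * 'I_n * 'I_n -> R[i]}.

Definition bracket (R : realType) (n : nat) (c : law R n)
    (x y : 'cV[R[i]]_n) : 'cV[R[i]]_n :=
  \col_k \sum_i \sum_j x i 0 * y j 0 * c (i, j, k).

Definition law_of (R : realType) (n : nat)
    (f : 'cV[R[i]]_n -> 'cV[R[i]]_n -> 'cV[R[i]]_n) : law R n :=
  [ffun t => f (delta_mx t.1.1 0) (delta_mx t.1.2 0) t.2 0].

Definition Leib (R : realType) (n : nat) : set (law R n) :=
  [set c | forall x y z : 'cV[R[i]]_n,
     bracket c x (bracket c y z)
     = bracket c (bracket c x y) z - bracket c (bracket c x z) y].
Arguments Leib : clear implicits.

(* (g * c)(x, y) = g (c (g^-1 x, g^-1 y)); see bracket_act. *)
Definition act (R : realType) (n : nat) (g : 'M[R[i]]_n) (c : law R n) :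
    law R n :=
  law_of (fun x y => g *m bracket c (invmx g *m x) (invmx g *m y)).

Definition orbit (R : realType) (n : nat) (c : law R n) : set (law R n) :=
  [set d | exists2 g : 'M[R[i]]_n, g \in unitmx & d = act g c].

(* The coordinates (i, j, k) of C^(n^3) are numbered by enum_val in order to  *)
(* serve as the variables of a polynomial.                                    *)
Definition zariski_closed (R : realType) (n : nat) (A : set (law R n)) : Prop :=
  exists S : set {mpoly R[i][#|{: 'I_n * 'I_n * 'I_n}|]},
    A = [set c | forall p, S p -> p.@[fun k => c (enum_val k)] = 0].

Definition zariski_open (R : realType) (n : nat) (A : set (law R n)) : Prop :=
  zariski_closed (~` A).

(* "open" refers to the topology induced on Leib R n by the Zariski topology  *)
(* of C^(n^3).                                                                *)
Definition rigid (R : realType) (n : nat) (c : law R n) : Prop :=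
  Leib R n c /\
  exists2 U : set (law R n), zariski_open U & orbit c = U `&` Leib R n.

(* x_1, ..., x_n: the canonical basis numbered from 1; basis_vec R n i = 0    *)
(* when i is not between 1 and n.                                             *)
Definition basis_vec (R : realType) (n i : nat) : 'cV[R[i]]_n :=
  \col_(k < n) (k.+1 == i)%:R.

(* [x_i, x_j] for 1 <= i, j <= n. *)
Definition algR_product (R : realType) (n i j : nat) : 'cV[R[i]]_n :=
  if (j == 1)%N && (2 <= i <= n - 1)%N then basis_vec R n i.+1
  else if (j == 2)%N && (i == 1)%N then basis_vec R n 1
  else if (j == 2)%N && (3 <= i <= n)%N then (i - 2)%N%:R *: basis_vec R n i
  else if (j == 3)%N && (2 <= i <= n - 1)%N then - basis_vec R n i.+1
  else 0.

Definition algR (R : realType) (n : nat) : law R n :=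
  [ffun t : 'I_n * 'I_n * 'I_n => algR_product R n t.1.1.+1 t.1.2.+1 t.2 0].

Section Facts.
Context (R : realType) (n : nat).
Implicit Types (c : law R n) (x y : 'cV[R[i]]_n) (g : 'M[R[i]]_n).

Lemma bracket_delta c (i j k : 'I_n) :
  bracket c (delta_mx i 0) (delta_mx j 0) k 0 = c (i, j, k).
Proof.
rewrite mxE (bigD1 i) //= (bigD1 j) //= big1 => [|j' /negPf nj].
  rewrite addr0 big1 => [|i' /negPf ni]; first by rewrite !mxE !eqxx !mul1r addr0.
  by rewrite big1 // => j' _; rewrite !mxE ni !mul0r.
by rewrite !mxE nj mulr0 mul0r.
Qed.

Lemma bracket_act g c x y :
  bracket (act g c) x y = g *m bracket c (invmx g *m x) (invmx g *m y).
Proof.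
set h := invmx g; apply/matrixP => k o; rewrite (ord1 o) {o} !mxE.
have E i j : act g c (i, j, k) =
    \sum_l g k l * (\sum_a \sum_b h a i * h b j * c (a, b, l)).
  rewrite ffunE mxE; apply: eq_bigr => l _; congr (_ * _).
  rewrite mxE; apply: eq_bigr => a _; apply: eq_bigr => b _ /=.
  by rewrite -!colE !mxE.
under eq_bigr => i _ do under eq_bigr => j _ do rewrite E mulr_sumr.
under eq_bigr => i _ do rewrite exchange_big /=.
rewrite exchange_big /=; apply: eq_bigr => l _.
rewrite mxE.
under eq_bigr => i _ do under eq_bigr => j _ do rewrite mulrCA.
under eq_bigr => i _ do rewrite -mulr_sumr.
rewrite -mulr_sumr; congr (_ * _).
under eq_bigr => i _ do under eq_bigr => j _ do
  (rewrite mulr_sumr; under eq_bigr => a _ do rewrite mulr_sumr).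
under eq_bigr => i _ do rewrite exchange_big /=.
rewrite exchange_big /=; apply: eq_bigr => a _.
under eq_bigr => i _ do rewrite exchange_big /=.
rewrite exchange_big /=; apply: eq_bigr => b _.
rewrite !mxE big_distrlr mulr_suml; apply: eq_bigr => i _.
rewrite mulr_suml; apply: eq_bigr => j _.
rewrite mulrA; congr (_ * _).
by rewrite mulrACA /= [x i 0 * _]mulrC [y j 0 * _]mulrC.
Qed.

Lemma bracket_algR (i j : 'I_n) :
  bracket (algR R n) (basis_vec R n i.+1) (basis_vec R n j.+1)
  = algR_product R n i.+1 j.+1.
Proof.
have bE (k : 'I_n) : basis_vec R n k.+1 = delta_mx k 0.
  by apply/matrixP => l o; rewrite !mxE (ord1 o) eqxx andbT eqSS.
apply/matrixP => k o; rewrite (ord1 o) {o} !bE bracket_delta.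
by rewrite ffunE.
Qed.

End Facts.

(* Main.v *)
Require Import Defs.
From HB Require Import structures.
From mathcomp Require Import all_boot all_algebra.
From mathcomp Require Import classical_sets reals.
From mathcomp Require Import complex mpoly.
From mathcomp Require Import perm ring.

(** A law is rigid as soon as it satisfies the Leibniz identity and some
    polynomial function of the structure constants is nonzero at it and vanishes
    at every Leibniz law outside its orbit ([rigid_of_regular]): the translates
    of a nonvanishing set by the linear group cover the orbit.

    Write R_y for the right multiplication x |-> [x, y].  The Leibniz identity
    says that R_[y, z] = R_z R_y - R_y R_z.  The algebra of the theorem is
    encoded by A = R_(x_1), a shift, and B = R_(x_2), a diagonal matrix, with
    B A - A B = A; moreover R_(x_3) = - A and R_(x_k) = 0 for k > 3.

    To recognize its orbit, one looks in a Leibniz law for vectors a and b such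
    that A = R_a and B = R_b satisfy B A - A B = A, B b = 0, and such that
    a, b, A b, A^2 b, ... is a basis.  Since B raises to weights, A^k b is then
    an eigenvector of B for the eigenvalue k, and the right multiplications by
    the vectors A^k b are forced to be B, - A, 0, 0, ...; only A a and B a are
    left to determine.  They differ by elements x with R_x = 0 from the values
    0 and a, and comparing coefficients in B A - A B = A shows that, outside a
    proper closed set, a can be corrected by such elements so that A a = 0 and
    B a = a ([normal_form]).  This gives the isomorphism ([orbit_algR_of_null]).

    It remains to produce a and b from the structure constants by polynomial
    formulas ([gen_a], [gen_b]).  Let chi be the characteristic polynomial of
    M = R_y.  The vectors M^k y with k > 0 lie in the kernel of x |-> R_x, so for
    v = ((chi - chi(0)) / X)(M) y the matrix R_v is a multiple of M; and by
    Cayley-Hamilton M v = - chi(0) y, where chi(0) = 0 unless R_v = 0.  Taking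
    y = x_2 makes [v, v] = 0, whence b up to a scalar, and a is then [x_1, v].
    Finally [x_1, v] + [v, x_1] always lies in the kernel of x |-> R_x; as soon
    as it generates under A a space of codimension two ([null_frame]), x_1 is
    a combination of a and v modulo that kernel, and B A - A B = A follows for
    a suitable multiple b of v.  The conditions used are collected in one
    polynomial [genericity], which does not vanish at the algebra of the theorem
    ([genericity_algR]). *)

Set Implicit Arguments.
Unset Strict Implicit.
Unset Printing Implicit Defensive.
Import GRing.Theory Num.Theory.
Local Open Scope ring_scope.

(** * Right multiplications and the action of the linear group *)

Lemma mulmx_delta_inj (R : realType) p q (g h : 'M[R[i]]_(p, q)) :
  (forall j, g *m delta_mx j 0 = h *m delta_mx j 0 :> 'cV_p) -> g = h.
Proof.
move=> gh; apply/matrixP => i j.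
by have /colP/(_ i) := gh j; rewrite -!colE !mxE.
Qed.

Section RightMultiplication.
Context (R : realType) (n : nat).
Implicit Types (c : law R n) (x y z : 'cV[R[i]]_n) (g h : 'M[R[i]]_n).

(** Right rather than left multiplications: with this form of the Leibniz
    identity they are the derivations. *)
Definition rmul c y : 'M[R[i]]_n :=
  \matrix_(k, i) \sum_j y j 0 * c (i, j, k).

Lemma rmulE c x y : rmul c y *m x = bracket c x y.
Proof.
apply/colP => k; rewrite !mxE; apply: eq_bigr => i _.
by rewrite mxE mulr_suml; apply: eq_bigr => j _; rewrite mulrC mulrA.
Qed.

Lemma rmul_is_linear c : linear (rmul c).
Proof.
move=> k x y; apply/matrixP => i j; rewrite !mxE mulr_sumr -big_split /=.
by apply: eq_bigr => l _; rewrite !mxE mulrDl mulrA.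
Qed.

HB.instance Definition _ c :=
  GRing.isLinear.Build R[i] 'cV[R[i]]_n 'M[R[i]]_n _ (rmul c) (rmul_is_linear c).

(** Trading the identity on triples of vectors for one on matrices is what lets
    the rest be done by linear algebra. *)
Lemma LeibP c :
  Leib R n c <->
  forall y z, rmul c (rmul c z *m y) = rmul c z *m rmul c y - rmul c y *m rmul c z.
Proof.
split=> [lc y z | lc x y z].
  apply: mulmx_delta_inj => j; rewrite mulmxBl -!mulmxA !rmulE.
  exact: lc.
have := congr1 (mulmx^~ x) (lc y z); rewrite mulmxBl -!mulmxA !rmulE.
by [].
Qed.

Lemma law_ext c c' :
  (forall x y, bracket c x y = bracket c' x y) -> c = c'.
Proof.
by move=> cc'; apply/ffunP => -[[i j] k]; rewrite -!bracket_delta cc'.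
Qed.

Lemma actM g h c : g \in unitmx -> h \in unitmx ->
  act g (act h c) = act (g *m h) c.
Proof.
move=> gu hu; apply: law_ext => x y.
have ghu : g *m h \in unitmx by rewrite unitmx_mul gu.
have ghV : invmx (g *m h) = invmx h *m invmx g.
  apply: (can_inj (mulmxK ghu)); rewrite mulVmx // mulmxA mulmxKV //.
  by rewrite mulVmx.
apply: etrans (bracket_act g (act h c) x y) _.
apply: etrans _ (esym (bracket_act (g *m h) c x y)); rewrite ghV.
rewrite (bracket_act h c).
rewrite -(mulmxA g h) -(mulmxA (invmx h) (invmx g) x).
rewrite -(mulmxA (invmx h) (invmx g) y).
reflexivity.
Qed.

Lemma act1 c : act 1%:M c = c.
Proof. by apply: law_ext => x y; rewrite bracket_act invmx1 !mul1mx. Qed.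

(** An isomorphism may be tested on right multiplications, which in the sequel
    depend on y through two scalars only. *)
Lemma act_rmulP g c c' : g \in unitmx ->
  (forall y, rmul c' (g *m y) *m g = g *m rmul c y) -> c' = act g c.
Proof.
move=> gu gc; apply: law_ext => x y; rewrite bracket_act -!rmulE.
by rewrite mulmxA -gc mulKVmx // -mulmxA mulKVmx.
Qed.

Lemma Leib_act g c : g \in unitmx -> Leib R n c -> Leib R n (act g c).
Proof.
move=> gu lc x y z; rewrite !bracket_act !mulKmx //.
by rewrite lc mulmxBr.
Qed.

End RightMultiplication.

(** * Polynomial functions of a law *)

Section Regular.
Context (R : realType) (n : nat).
Implicit Types (f g : law R n -> R[i]).

(** The polynomial functions of the structure constants, with the numbering of
    coordinates by [enum_val] that the Zariski topology uses. *)
Definition regular f : Prop :=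
  exists p : {mpoly R[i][#|{: 'I_n * 'I_n * 'I_n}|]},
    forall c, f c = p.@[fun k => c (enum_val k)].

Lemma regular_ext f g : f =1 g -> regular f -> regular g.
Proof. by move=> fg [p fp]; exists p => c; rewrite -fg. Qed.

Lemma regular_cst a : regular (fun=> a).
Proof. by exists a%:MP => c; rewrite mevalC. Qed.

Lemma regular_coord t : regular (fun c => c t).
Proof. by exists 'X_(enum_rank t) => c; rewrite mevalXU enum_rankK. Qed.

Lemma regularD f g : regular f -> regular g -> regular (fun c => f c + g c).
Proof. by move=> [p fp] [q gq]; exists (p + q) => c; rewrite mevalD fp gq. Qed.

Lemma regularM f g : regular f -> regular g -> regular (fun c => f c * g c).
Proof. by move=> [p fp] [q gq]; exists (p * q) => c; rewrite mevalM fp gq. Qed.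

Lemma regularN f : regular f -> regular (fun c => - f c).
Proof. by move=> [p fp]; exists (- p) => c; rewrite mevalN fp. Qed.

Lemma regular_sum (I : Type) (r : seq I) (P : pred I) (F : I -> law R n -> R[i]) :
  (forall i, P i -> regular (F i)) -> regular (fun c => \sum_(i <- r | P i) F i c).
Proof.
move=> rF; elim: r => [|i r IHr].
  by apply: regular_ext (regular_cst 0) => c; rewrite big_nil.
case Pi: (P i); last by apply: regular_ext IHr => c; rewrite big_cons Pi.
by apply: regular_ext (regularD (rF i Pi) IHr) => c; rewrite big_cons Pi.
Qed.

Lemma regular_prod (I : Type) (r : seq I) (P : pred I) (F : I -> law R n -> R[i]) :
  (forall i, P i -> regular (F i)) -> regular (fun c => \prod_(i <- r | P i) F i c).
Proof.
move=> rF; elim: r => [|i r IHr].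
  by apply: regular_ext (regular_cst 1) => c; rewrite big_nil.
case Pi: (P i); last by apply: regular_ext IHr => c; rewrite big_cons Pi.
by apply: regular_ext (regularM (rF i Pi) IHr) => c; rewrite big_cons Pi.
Qed.

Lemma regular_exp f k : regular f -> regular (fun c => f c ^+ k).
Proof.
move=> rf; elim: k => [|k IHk]; first exact: regular_cst.
by apply: regular_ext (regularM rf IHk) => c; rewrite exprS.
Qed.

Lemma regular_comp f (phi : law R n -> law R n) :
  regular f -> (forall t, regular (fun c => phi c t)) ->
  regular (fun c => f (phi c)).
Proof.
move=> [p fp] rphi.
apply: (regular_ext (f := fun c => \sum_(m <- msupp p) p@_m *
    \prod_i phi c (enum_val i) ^+ m i)).
  by move=> c; rewrite fp mevalE.
apply: regular_sum => m _; apply: regularM; first exact: regular_cst.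
by apply: regular_prod => i _; apply: regular_exp.
Qed.

Definition regular_mx (m p : nat) (f : law R n -> 'M[R[i]]_(m, p)) : Prop :=
  forall i j, regular (fun c => f c i j).

Lemma regular_mx_cst m p (a : 'M_(m, p)) : regular_mx (fun=> a).
Proof. by move=> i j; apply: regular_cst. Qed.

Lemma regular_mxM m p q (f : law R n -> 'M_(m, p)) (g : law R n -> 'M_(p, q)) :
  regular_mx f -> regular_mx g -> regular_mx (fun c => f c *m g c).
Proof.
move=> rf rg i j.
apply: (regular_ext (f := fun c => \sum_k f c i k * g c k j)) => [c|].
  by rewrite mxE.
by apply: regular_sum => k _; apply: regularM.
Qed.

Lemma regular_mxD m p (f g : law R n -> 'M_(m, p)) :
  regular_mx f -> regular_mx g -> regular_mx (fun c => f c + g c).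
Proof.
move=> rf rg i j.
by apply: regular_ext (regularD (rf i j) (rg i j)) => c; rewrite mxE.
Qed.

Lemma regular_mxZ m p (k : law R n -> R[i]) (f : law R n -> 'M[R[i]]_(m, p)) :
  regular k -> regular_mx f -> regular_mx (fun c => k c *: f c).
Proof.
by move=> rk rf i j; apply: regular_ext (regularM rk (rf i j)) => c; rewrite mxE.
Qed.

Lemma regular_mx_sum m p (I : Type) (r : seq I)
    (F : I -> law R n -> 'M[R[i]]_(m, p)) :
  (forall i, regular_mx (F i)) -> regular_mx (fun c => \sum_(i <- r) F i c).
Proof.
move=> rF k l.
apply: (regular_ext (f := fun c => \sum_(i <- r) F i c k l)) => [c|].
  by rewrite summxE.
by apply: regular_sum => i _; apply: rF.
Qed.

Lemma regular_det m (f : law R n -> 'M_m) :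
  regular_mx f -> regular (fun c => \det (f c)).
Proof.
move=> rf; apply: regular_sum => s _.
apply: regularM; first exact: regular_cst.
exact: regular_prod.
Qed.

Lemma regular_adj m (f : law R n -> 'M_m) :
  regular_mx f -> regular_mx (fun c => \adj (f c)).
Proof.
move=> rf i j.
apply: (regular_ext (f := fun c => (-1) ^+ (j + i) * \det (row' j (col' i (f c))))).
  by move=> c; rewrite mxE.
apply: regularM; first exact: regular_cst.
apply: regular_det => k l.
by apply: regular_ext (rf (lift j k) (lift i l)) => c; rewrite !mxE.
Qed.

Lemma regular_mxX m (f : law R n -> 'M_m.+1) k :
  regular_mx f -> regular_mx (fun c => f c ^+ k).
Proof.
move=> rf; elim: k => [|k IHk]; first exact: regular_mx_cst.
by move=> i j; apply: regular_ext (regular_mxM rf IHk i j) => c; rewrite exprS.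
Qed.

Lemma regular_rmul (y : law R n -> 'cV_n) :
  regular_mx y -> regular_mx (fun c => rmul c (y c)).
Proof.
move=> ry k i.
apply: (regular_ext (f := fun c => \sum_j y c j 0 * c (i, j, k))).
  by move=> c; rewrite mxE.
by apply: regular_sum => j _; apply: regularM => //; apply: regular_coord.
Qed.

(** The determinant of the characteristic matrix is expanded over the
    permutations, and coefficients of products of polynomials are convolutions. *)
Lemma regular_char_poly m (f : law R n -> 'M_m) k :
  regular_mx f -> regular (fun c => (char_poly (f c))`_k).
Proof.
move=> rf.
pose regp (p : law R n -> {poly R[i]}) := forall k, regular (fun c => (p c)`_k).
have regpM p q : regp p -> regp q -> regp (fun c => p c * q c).
  move=> rp rq l.
  apply: (regular_ext (f := fun c => \sum_(j < l.+1) (p c)`_j * (q c)`_(l - j))).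
    by move=> c; rewrite coefM.
  by apply: regular_sum => j _; apply: regularM.
have regp_cst p : regp (fun=> p) by move=> l; apply: regular_cst.
apply: (regular_ext (f := fun c => \sum_(s : 'S_m)
    ((-1) ^+ s * \prod_i char_poly_mx (f c) i (s i))`_k)).
  by move=> c; rewrite -coef_sum.
apply: regular_sum => s _; move: k; apply: (regpM _ _ (regp_cst _)).
elim: (index_enum _) => [|i r IHr] l.
  by apply: regular_ext (regp_cst 1 l) => c; rewrite big_nil.
apply: (regular_ext (f := fun c => (char_poly_mx (f c) i (s i) *
    \prod_(i <- r) char_poly_mx (f c) i (s i))`_l)) => [c|].
  by rewrite big_cons.
apply: regpM => // {}l.
apply: (regular_ext (f := fun c => (('X *+ (i == s i))`_l : R[i]) -
    (f c i (s i) * (l == 0)%:R))) => [c|].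
  rewrite !mxE coefB coefC; congr (_ - _).
  by case: eqP; rewrite ?mulr1 ?mulr0.
apply: regularD; first exact: regular_cst.
apply: regularN; apply: regularM => //; exact: regular_cst.
Qed.

Lemma regular_act (g : 'M_n) t : regular (fun c : law R n => act g c t).
Proof.
case: t => [[i j] k].
pose e l : 'cV[R[i]]_n := invmx g *m delta_mx l 0.
apply: (regular_ext (f := fun c => (g *m (rmul c (e j) *m e i)) k 0)) => [c|].
  by rewrite ffunE rmulE.
apply: (regular_mxM (regular_mx_cst _)); apply: regular_mxM.
  by apply: regular_rmul; apply: regular_mx_cst.
exact: regular_mx_cst.
Qed.

Local Open Scope classical_set_scope.

(** The set of laws with a translate where f is nonzero is open, being the
    complement of the common zeros of the functions f (act g c); it is invariant,
    so its Leibniz points form exactly one orbit. *)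
Lemma rigid_of_regular (c0 : law R n) f :
  Leib R n c0 -> regular f -> f c0 != 0 ->
  (forall c, Leib R n c -> f c != 0 -> Defs.orbit c0 c) -> rigid c0.
Proof.
move=> lc0 rf f0 fo; split=> //.
exists [set c | exists2 g, g \in unitmx & f (act g c) != 0].
  exists [set p | exists2 g, g \in unitmx &
            forall c, f (act g c) = p.@[fun k => c (enum_val k)]].
  apply/seteqP; split=> c /=.
    by move=> nc p [g gu gp]; rewrite -gp; apply/eqP/negP => /negP ?; apply: nc; exists g.
  move=> cp [g gu /eqP]; apply.
  have [p fp] := regular_comp rf (regular_act g).
  by rewrite fp cp //; exists g.
apply/seteqP; split=> c /=.
  move=> [h hu ->]; split; last exact: Leib_act.
  by exists (invmx h); rewrite ?unitmx_inv // actM ?unitmx_inv // mulVmx // act1.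
move=> [[g gu fg] lc].
have [h hu gh] := fo _ (Leib_act gu lc) fg.
exists (invmx g *m h); first by rewrite unitmx_mul unitmx_inv gu.
have giu : invmx g \in unitmx by rewrite unitmx_inv.
rewrite -(actM c0 giu hu) -gh (actM c giu gu) (mulVmx gu).
by rewrite (act1 c).
Qed.

End Regular.

(** * Pairs of matrices with B A - A B = A *)

Lemma scaled_sum_shift (F : nzRingType) (V : lmodType F) p (t : nat -> F)
    (u : nat -> V) : u p = 0 ->
  \sum_(k < p) t k *: u k.+1
  = \sum_(k < p) (if (k : nat) is k'.+1 then t k' else 0) *: u k.
Proof.
case: p => [|p] up; first by rewrite !big_ord0.
by rewrite big_ord_recr big_ord_recl /= up scaler0 scale0r addr0 add0r.
Qed.

Section Combination.
Context (F : numFieldType) (n : nat) (A B : 'M[F]_n.+1) (a b : 'cV[F]_n.+1).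
Context (BA : B *m A - A *m B = A).
Context (Bb : B *m b = 0).

Definition chain k : 'cV[F]_n.+1 := A ^+ k *m b.

Lemma chain0 : chain 0 = b.
Proof. by rewrite /chain expr0 mul1mx. Qed.

Lemma chainS k : A *m chain k = chain k.+1.
Proof. by rewrite /chain exprS mulmxA. Qed.

(** The relation B A - A B = A makes A a raising operator for the eigenvalues
    of B. *)
Lemma weight_raise (x : 'cV_n.+1) k :
  B *m x = k *: x -> B *m (A *m x) = (k + 1) *: (A *m x).
Proof.
have BAE : B *m A = A + A *m B by apply/eqP; rewrite -subr_eq BA.
move=> Bx; rewrite mulmxA BAE mulmxDl -(mulmxA A) Bx -scalemxAr.
by rewrite addrC scalerDl scale1r.
Qed.

Lemma weight_chain k : B *m chain k = k%:R *: chain k.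
Proof.
elim: k => [|k IHk]; first by rewrite scale0r chain0.
by rewrite -chainS (weight_raise IHk) natr1.
Qed.

(** Coefficients are indexed by all natural numbers, only the first n of them
    being read: shifting and scaling the family t then needs no casts between
    ordinals. *)
Definition comb (xi : F) (t : nat -> F) : 'cV[F]_n.+1 :=
  xi *: a + \sum_(k < n) t k *: chain k.

Lemma eq_comb xi t t' : (forall k, (k < n)%N -> t k = t' k) ->
  comb xi t = comb xi t'.
Proof. by move=> tt; congr (_ + _); apply: eq_bigr => k _; rewrite tt. Qed.

Lemma combD xi t xi' t' :
  comb xi t + comb xi' t' = comb (xi + xi') (fun k => t k + t' k).
Proof.
rewrite /comb addrACA -scalerDl -big_split /=; congr (_ + _).
by apply: eq_bigr => k _; rewrite scalerDl.
Qed.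

Lemma combZ x xi t : x *: comb xi t = comb (x * xi) (fun k => x * t k).
Proof.
rewrite /comb scalerDr scalerA scaler_sumr; congr (_ + _).
by apply: eq_bigr => k _; rewrite scalerA.
Qed.

Lemma comb_a : a = comb 1 (fun=> 0).
Proof. by rewrite /comb scale1r big1 ?addr0 // => k _; rewrite scale0r. Qed.

Lemma comb_chain j : (j < n)%N -> chain j = comb 0 (fun k => (k == j)%:R).
Proof.
move=> jn; rewrite /comb scale0r add0r (bigD1 (Ordinal jn)) //= eqxx scale1r.
rewrite big1 ?addr0 // => k /negPf; rewrite -(inj_eq val_inj) /= => ->.
by rewrite scale0r.
Qed.

Lemma weight_comb xi t :
  B *m comb xi t = xi *: (B *m a) + comb 0 (fun k => k%:R * t k).
Proof.
rewrite /comb scale0r add0r mulmxDr -scalemxAr mulmx_sumr; congr (_ + _).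
apply: eq_bigr => k _; rewrite -scalemxAr weight_chain scalerA; congr (_ *: _).
exact: mulrC.
Qed.

Lemma shift_comb xi t : chain n = 0 ->
  A *m comb xi t
  = xi *: (A *m a) + comb 0 (fun k => if k is k'.+1 then t k' else 0).
Proof.
move=> ch; rewrite /comb scale0r add0r mulmxDr -scalemxAr mulmx_sumr.
congr (_ + _); under eq_bigr => k _ do rewrite -scalemxAr chainS.
exact: scaled_sum_shift.
Qed.

End Combination.

Section Frame.
Context (F : numFieldType) (n : nat) (A : 'M[F]_n.+1) (a b : 'cV[F]_n.+1).
Local Notation comb := (comb A a b).

Definition frame : 'M[F]_n.+1 :=
  \matrix_(k, j) (if j == 0 :> nat then a else chain A b j.-1) k 0.

Lemma col_frame (j : 'I_n.+1) :
  frame *m delta_mx j 0 = if j == 0 :> nat then a else chain A b j.-1.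
Proof. by rewrite -colE; apply/colP => k; rewrite !mxE. Qed.

Lemma frame_mul (z : 'cV_n.+1) :
  frame *m z = comb (z 0 0) (fun k => z (inord k.+1) 0).
Proof.
apply/colP => k; rewrite mxE big_ord_recl !mxE summxE /= mulrC; congr (_ + _).
apply: eq_bigr => j _; rewrite !mxE /= mulrC; congr (z _ 0 * _).
by apply: val_inj; rewrite /= inordK // ltnS.
Qed.

Lemma comb_frame xi t :
  comb xi t = frame *m \col_j (if j == 0 :> nat then xi else t j.-1).
Proof.
rewrite frame_mul mxE /=; apply: eq_comb => k kn.
by rewrite mxE /= inordK.
Qed.

Lemma comb_frame_surj x : frame \in unitmx -> exists xi t, x = comb xi t.
Proof.
by move=> fu; rewrite -[x](mulKVmx fu) frame_mul; do 2 eexists; reflexivity.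
Qed.

Lemma comb_frame_inj xi t xi' t' : frame \in unitmx ->
  comb xi t = comb xi' t' -> xi = xi' /\ forall k, (k < n)%N -> t k = t' k.
Proof.
move=> fu; rewrite !comb_frame => /(can_inj (mulKmx fu)) /colP E.
split=> [|k kn]; first by have := E 0; rewrite !mxE.
by have := E (inord k.+1); rewrite !mxE /= inordK.
Qed.

End Frame.

(** Commuting a relation x A + y B = 0 with A kills its first term and leaves
    y A = 0. *)
Lemma comm_eq_free (F : fieldType) n (A B : 'M[F]_n) x y :
  B *m A - A *m B = A -> A != 0 -> x *: A + y *: B = 0 -> x = 0 /\ y = 0.
Proof.
move=> BA A0 E; have y0 : y = 0.
  have /eqP := congr1 (fun X => X *m A - A *m X) E.
  rewrite /= mulmxDl mulmxDr -!scalemxAl -!scalemxAr opprD addrACA subrr add0r.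
  rewrite -scalerBr BA.
  by rewrite mul0mx mulmx0 subrr scaler_eq0 (negPf A0) orbF => /eqP.
move/eqP: E; rewrite y0 scale0r addr0 scaler_eq0 (negPf A0) orbF.
by move/eqP.
Qed.

Lemma unitmx_ker0 (F : fieldType) n (M : 'M[F]_n) :
  (forall z : 'cV_n, M *m z = 0 -> z = 0) -> M \in unitmx.
Proof.
move=> M0; rewrite -unitmx_tr -row_free_unit; apply: inj_row_free => v vM.
by apply: trmx_inj; rewrite trmx0; apply: M0; rewrite -[M]trmxK -trmx_mul vM trmx0.
Qed.

Lemma frame_comb_unit (F : numFieldType) n (A : 'M[F]_n.+1) a b xi t :
  xi != 0 -> frame A a b \in unitmx -> frame A (comb A a b xi t) b \in unitmx.
Proof.
move=> xi0 fu; apply: unitmx_ker0 => z.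
pose z' k := z (inord k.+1) 0.
have -> : frame A (comb A a b xi t) b *m z =
    comb A a b (z 0 0 * xi) (fun k => z 0 0 * t k + z' k).
  rewrite frame_mul {1}/comb combZ.
  have -> : \sum_(k < n) z (inord k.+1) 0 *: chain A b k = comb A a b 0 z'.
    by rewrite /comb scale0r add0r.
  by rewrite combD addr0.
have c0 : comb A a b 0 (fun=> 0) = 0.
  by rewrite /comb scale0r big1 ?addr0 // => k _; rewrite scale0r.
move=> E; have {E} [/eqP] := comb_frame_inj fu (etrans E (esym c0)).
rewrite mulf_eq0 (negPf xi0) orbF => /eqP z0 zk; apply/colP => j; rewrite [RHS]mxE.
case: (unliftP 0 j) => [k ->|->]; last exact: z0.
have := zk k (ltn_ord k); rewrite z0 mul0r add0r => <-; congr (z _ 0).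
by apply: val_inj; rewrite /= inordK // ltnS.
Qed.

Section NormalForm.
Context (F : numFieldType) (m : nat) (A B : 'M[F]_m.+4) (a b : 'cV[F]_m.+4).
Local Notation comb := (comb A a b).
Local Notation chain := (chain A b).

Lemma comb0 xi t : xi = 0 -> (forall k, (k < m.+3)%N -> t k = 0) -> comb xi t = 0.
Proof.
move=> -> t0; rewrite /comb scale0r add0r big1 // => k _.
by rewrite t0 // scale0r.
Qed.

Lemma linear_comb (V : lmodType F) (f : {linear 'cV[F]_m.+4 -> V}) xi t :
  (forall k, f (chain k.+2) = 0) ->
  f (comb xi t) = xi *: f a + (t 0%N *: f b + t 1%N *: f (chain 1)).
Proof.
move=> f0; rewrite /comb linearD linearZ linear_sum !big_ord_recl big1 => [|k _].
  by rewrite !linearZ /= f0 scaler0 !addr0 chain0.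
by rewrite linearZ /= f0 scaler0.
Qed.

Lemma shift_comb_iter t j : chain m.+3 = 0 ->
  A ^+ j *m comb 0 t = comb 0 (fun k => if (k < j)%N then 0 else t (k - j)%N).
Proof.
move=> ch; elim: j => [|j IHj].
  by rewrite expr0 mul1mx; apply: eq_comb => k _; rewrite subn0.
rewrite exprS -mulmxE -mulmxA IHj shift_comb // scale0r add0r.
by apply: eq_comb => -[|k] _ //; rewrite ltnS subSS.
Qed.

(** K stands for the kernel of x |-> R_x.  Write B a = (1 + s) a + s A b + ...
    The vector A^n b (n = m + 3) has weight n, while the weights of the frame are
    0, ..., n - 1 and 1 + s; hence it vanishes when 1 + s <> n.  Then the
    coefficient of A^2 b in B A a - A B a = A a reads s (1 + p 2) = 0, where p 2
    is the coefficient of A^2 b in A a, and 1 + p 2 = 0 would force A^(n - 2) to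
    vanish on K.  So s = 0, the terms of higher weight in B a can be removed by
    changing a, and A a, having weight 2, becomes a multiple of A^2 b; a further
    change along a + A b, which has weight 1, cancels it. *)
Lemma normal_form (K : 'cV[F]_m.+4 -> Prop) (w : 'cV_m.+4) :
  B *m A - A *m B = A -> B *m b = 0 -> frame A a b \in unitmx ->
  (forall xi t, K (comb xi t) -> t 0%N = 0 /\ t 1%N = xi) ->
  K (B *m a - a) -> K (A *m a) -> K (chain m.+3) ->
  K w -> A ^+ m.+1 *m w != 0 ->
  (forall t, B *m a <> comb m.+3%:R t) ->
  chain m.+3 = 0 /\
  exists r t, [/\ r != 1, t 0%N = 0 /\ t 1%N = - r,
    B *m comb (1 - r) t = comb (1 - r) t & A *m comb (1 - r) t = 0].
Proof.
move=> BA Bb fu hK KBa KAa Kch Kw wN0 hs.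
have inj xi t xi' t' := @comb_frame_inj _ _ _ _ _ xi t xi' t' fu.
have [s [t Ba]] : exists s t, B *m a - a = comb s t by apply: comb_frame_surj.
have [t0 t1] : t 0%N = 0 /\ t 1%N = s by apply: hK; rewrite -Ba.
(* K contains B a - a, which has equal coefficients at a and at A b. *)
have {}Ba : B *m a = comb (1 + s) t.
  rewrite -[B *m a](subrK a) Ba {2}(comb_a A a b) combD addrC.
  by apply: eq_comb => k _; rewrite addr0.
have s1 : 1 + s != m.+3%:R by apply/eqP => s1; apply: (hs t); rewrite Ba s1.
have ch : chain m.+3 = 0.
  have [u [l chE]] : exists u l, chain m.+3 = comb u l by apply: comb_frame_surj.
  have := weight_chain BA Bb m.+3.
  rewrite chE (weight_comb a BA Bb) Ba !combZ combD => /inj [].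
  rewrite addr0 => /eqP; rewrite [m.+3%:R * u]mulrC -subr_eq0 -mulrBr mulf_eq0.
  rewrite subr_eq0 (negPf s1) orbF => /eqP -> E.
  apply: comb0 => // k kn; have /eqP := E k kn.
  rewrite mul0r add0r -subr_eq0 -mulrBl mulf_eq0 subr_eq0 eqr_nat.
  by rewrite (ltn_eqF kn) => /eqP.
split=> //.
have [u [p Aa]] : exists u p, A *m a = comb u p by apply: comb_frame_surj.
have [p0 p1] : p 0%N = 0 /\ p 1%N = u by apply: hK; rewrite -Aa.
(* The coefficients of a and of A^2 b in B A a - A B a = A a. *)
have [u0 sp] : u = 0 /\ s * (1 + p 2%N) = 0.
  have := congr1 (mulmx^~ a) BA; rewrite /= mulmxBl -!mulmxA Aa Ba.
  rewrite (weight_comb a BA Bb) Ba shift_comb // Aa !combZ !combD -scaleN1r.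
  rewrite combZ combD => /inj [Ea Et].
  have u0 : u = 0 by rewrite -Ea; ring.
  split=> //; have := Et 2%N isT; rewrite /= u0 t1 => E.
  by rewrite -(subrr (p 2%N)) -{3}E; ring.
rewrite u0 {u u0} in Aa p1.
have p2 : 1 + p 2%N != 0.
  have [u [x wE]] : exists u x, w = comb u x by apply: comb_frame_surj.
  have [x0 x1] : x 0%N = 0 /\ x 1%N = u by apply: hK; rewrite -wE.
  apply: contraNneq wN0 => p2.
  have {}wE : w = u *: a + comb 0 x by rewrite wE {2}/comb scale0r add0r.
  have AAa : A ^+ m.+1 *m a = A ^+ m *m comb 0 p.
    by rewrite exprSr -Aa mulmxA.
  rewrite wE mulmxDr -scalemxAr AAa.
  rewrite !shift_comb_iter // combZ combD; apply/eqP; apply: comb0 => [|k kn].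
    by rewrite mulr0 addr0.
  case: (ltnP k m) => [km | mk].
    by rewrite (leqW km) !mulr0 addr0.
  rewrite -(subnKC mk) in kn *; move: (k - m)%N kn => j.
  rewrite -addn3 -[m.+1]addn1 ltn_add2l subnDl addKn ltn_add2l.
  case: j => [|[|[|//]]] _ /=; rewrite ?subnn ?p0 ?p1 ?x0 ?x1 ?mulr0 ?addr0 //.
  by rewrite -[RHS](mulr0 u) -p2; ring.
have s0 : s = 0 by move/eqP: sp; rewrite mulf_eq0 (negPf p2) orbF => /eqP.
rewrite s0 addr0 in Ba t1.
(* A term t k *: A^k b of B a is absorbed by - t k / (k - 1) times A^k b,
   which has weight k instead of 1. *)
pose v k : F := if (k < 2)%N then 0 else - (t k / (k%:R - 1)).
have vE k : (k < m.+3)%N -> t k + k%:R * v k = v k.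
  case: k => [|[|k]] _; rewrite /v /= ?t0 ?t1 ?mulr0 ?addr0 //.
  rewrite -addn1 natrD addrK; field.
  by rewrite nat1r pnatr_eq0.
pose a1 := comb 1 v.
have Ba1 : B *m a1 = 1 *: a1.
  rewrite (weight_comb a BA Bb) !scale1r Ba combD addr0.
  exact: eq_comb.
have Aa1 : A *m a1 = comb 0 (fun k => if k == 2%N then p 2%N else 0).
  have [q qE] : exists q, A *m a1 = comb 0 q.
    by rewrite shift_comb // scale1r Aa combD addr0; eexists.
  have := weight_raise BA Ba1; rewrite qE (weight_comb a BA Bb) scale0r add0r.
  rewrite combZ => /inj [_ qk].
  have q2 : q 2%N = p 2%N.
    move: qE; rewrite shift_comb // scale1r Aa combD => /inj [_ /(_ 2%N isT) <-].
    by rewrite /v /= addr0.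
  apply: eq_comb => k kn; case: eqP => [->|/eqP k2]; first exact: q2.
  have /eqP := qk k kn; rewrite -subr_eq0 -mulrBl mulf_eq0 subr_eq0.
  by rewrite (_ : 1 + 1 = 2%:R) // eqr_nat (negPf k2) => /eqP.
(* Replacing a1 by a1 - r (a1 + A b) adds - r (p 2 + 1) A^2 b to A a1. *)
pose r := p 2%N / (1 + p 2%N).
pose t' k : F := (1 - r) * v k + - r * (k == 1%N)%:R.
have r1 : 1 - r = (1 + p 2%N)^-1 by rewrite /r; field.
have a'E : comb (1 - r) t' = (1 - r) *: a1 + - r *: chain 1.
  by rewrite (comb_chain A a b (j := 1)) // !combZ combD mulr1 mulr0 addr0.
exists r, t'; split.
- by rewrite eq_sym -subr_eq0 r1 invr_eq0.
- by rewrite /t' /v /= !mulr0 addr0 add0r mulr1.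
- rewrite a'E mulmxDr -!scalemxAr Ba1 (weight_chain BA Bb).
  by rewrite scale1r scale1r.
rewrite a'E mulmxDr -!scalemxAr Aa1 chainS (comb_chain A a b (j := 2)) // !combZ combD.
apply: comb0 => [|k _]; first by rewrite !mulr0 addr0.
case: eqP => _ /=; last by rewrite !mulr0 addr0.
by rewrite r1 /r; field.
Qed.

End NormalForm.

Lemma det_neq0_unitmx (R : realType) n (M : 'M[R[i]]_n) :
  \det M != 0 -> M \in unitmx.
Proof. by rewrite unitmxE unitfE. Qed.

Lemma linear_mulmx_col2 (R : realType) p q (V : lmodType R[i])
    (f : {linear 'cV[R[i]]_p -> V}) (g : 'M_(p, q.+2)) (z : 'cV_q.+2) :
  (forall j : 'I_q.+2, (1 < j)%N -> f (col j g) = 0) ->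
  f (g *m z) = z ord0 0 *: f (col ord0 g)
    + z (lift ord0 ord0) 0 *: f (col (lift ord0 ord0) g).
Proof.
move=> f0; have -> : g *m z = \sum_j z j 0 *: col j g.
  apply/colP => k; rewrite mxE summxE; apply: eq_bigr => j _.
  by rewrite !mxE mulrC.
rewrite linear_sum !big_ord_recl big1 => [|j _]; last by rewrite linearZ /= f0 ?scaler0.
by rewrite addr0 !linearZ.
Qed.

Lemma unitmx_col_neq0 (F : fieldType) n (M : 'M[F]_n) j :
  M \in unitmx -> col j M != 0.
Proof.
move=> Mu; apply/eqP; rewrite colE => /(congr1 (mulmx (invmx M))).
rewrite mulKmx // mulmx0 => /colP/(_ j)/eqP.
by rewrite !mxE !eqxx oner_eq0.
Qed.

Section AdjFrame.
Context (F : numFieldType) (n : nat) (A : 'M[F]_n.+1) (a b : 'cV[F]_n.+1).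

(** The adjugate replaces the inverse of a frame so that coordinates, up to the
    determinant, are polynomial. *)
Lemma adj_frame xi t :
  \adj (frame A a b) *m comb A a b xi t =
  \det (frame A a b) *: \col_j (if j == 0 :> nat then xi else t j.-1).
Proof. by rewrite comb_frame mulmxA mul_adj_mx mul_scalar_mx. Qed.

Lemma chainZ x k : chain A (x *: b) k = x *: chain A b k.
Proof. by rewrite /chain scalemxAr. Qed.

Lemma combZr x xi t : comb A a (x *: b) xi t = comb A a b xi (fun k => x * t k).
Proof.
congr (_ + _); apply: eq_bigr => k _.
by rewrite chainZ scalerA mulrC.
Qed.

Lemma frameZr_unit x :
  x != 0 -> frame A a b \in unitmx -> frame A a (x *: b) \in unitmx.
Proof.
move=> x0 fu.
have -> : frame A a (x *: b) =
    frame A a b *m diag_mx (\row_j if j == 0 :> nat then 1 else x).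
  apply/matrixP => k j; rewrite mul_mx_diag !mxE.
  by case: eqP => _; rewrite ?mulr1 // chainZ mxE mulrC.
rewrite unitmx_mul fu unitmxE det_diag unitfE; apply/prodf_neq0 => j _.
by rewrite mxE; case: ifP => // _; apply: oner_neq0.
Qed.

Lemma frame_neq0 : frame A a b \in unitmx ->
  a != 0 /\ forall k, (k < n)%N -> chain A b k != 0.
Proof.
move=> fu; split=> [|k kn].
  by have := unitmx_col_neq0 0 fu; rewrite colE col_frame.
by have := unitmx_col_neq0 (Ordinal (kn : k.+1 < n.+1)%N) fu; rewrite colE col_frame.
Qed.

(** With N = x^-1 B, the hypotheses say that the coefficient of a in B a is y; as
    A b has weight 1, the two coordinates compare y with 1, whatever the
    unknown scale x is. *)
Lemma adj_frame_weights (N : 'M[F]_n.+1) x y t (j : 'I_n.+1) :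
  x != 0 -> x *: (N *m A - A *m N) = A -> N *m b = 0 ->
  x *: (N *m a) = comb A a b y t -> j = 2%N :> nat ->
  (\adj (frame A a b) *m (N *m a)) 0 0
  = y * (\adj (frame A a b) *m (N *m (A *m b))) j 0.
Proof.
move=> x0 xNA Nb Na j2; have n1 : (1 < n)%N by rewrite -ltnS -j2.
have {}Na : N *m a = x^-1 *: comb A a b y t by rewrite -Na scalerA mulVf ?scale1r.
have NAb : N *m (A *m b) = x^-1 *: chain A b 1.
  have NA : N *m A = x^-1 *: A + A *m N.
    by apply/eqP; rewrite -subr_eq -[in x^-1 *: A]xNA scalerA mulVf ?scale1r.
  by rewrite mulmxA NA mulmxDl -(mulmxA A) Nb mulmx0 addr0 -scalemxAl -chainS chain0.
rewrite Na NAb (comb_chain A a b n1) -!scalemxAr !adj_frame !mxE j2 /=.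
by ring.
Qed.

(** When a and A b have the same weight x, the quantity that
    [adj_frame_weights] detects is nonzero for y <> 1. *)
Lemma adj_frame_diff (N : 'M[F]_n.+1) x y (j : 'I_n.+1) :
  N *m a = x *: a -> N *m (A *m b) = x *: (A *m b) -> j = 2%N :> nat ->
  (\adj (frame A a b) *m (N *m a)) 0 0
    - y * (\adj (frame A a b) *m (N *m (A *m b))) j 0
  = (1 - y) * (x * \det (frame A a b)).
Proof.
move=> Na NAb j2; have n1 : (1 < n)%N by rewrite -ltnS -j2.
have adj_a : \adj (frame A a b) *m a = \det (frame A a b) *:
    \col_j (if j == 0 :> nat then 1 else 0).
  by rewrite -(adj_frame 1 (fun=> 0)) -comb_a.
have Ab : A *m b = comb A a b 0 (fun k => (k == 1%N)%:R).
  by rewrite -(comb_chain A a b n1) -chainS chain0.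
rewrite Na NAb Ab -!scalemxAr adj_a adj_frame !mxE j2 /=.
by ring.
Qed.

End AdjFrame.

Lemma comm_pencil_self (F : comNzRingType) n (A N : 'M[F]_n) x y :
  N *m (x *: A + y *: N) - (x *: A + y *: N) *m N = x *: (N *m A - A *m N).
Proof.
rewrite mulmxDl mulmxDr -!scalemxAl -!scalemxAr opprD addrACA subrr addr0.
by rewrite scalerBr.
Qed.

Section CayleyHamilton.
Context (F : fieldType) (n : nat) (M : 'M[F]_n.+1) (x : 'cV[F]_n.+1).

(** The image of x under ((chi - chi(0)) / X)(M), for chi the characteristic
    polynomial of M. *)
Definition char_quotient : 'cV[F]_n.+1 :=
  \sum_(k < n.+1) (char_poly M)`_k.+1 *: (M ^+ k *m x).

Lemma mulmx_char_quotient : M *m char_quotient = - (char_poly M)`_0 *: x.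
Proof.
apply/eqP; rewrite scaleNr -addr_eq0; apply/eqP.
have := congr1 (mulmx^~ x) (Cayley_Hamilton M); rewrite /= mul0mx => <-.
have sz : (size (map_poly (@scalar_mx F n.+1) (char_poly M)) <= n.+2)%N.
  by rewrite size_map_poly size_char_poly.
rewrite /horner_mx /horner_morph (horner_coef_wide _ sz) mulmx_suml.
rewrite big_ord_recl addrC /char_quotient mulmx_sumr; congr (_ + _).
  by rewrite coef_map /= expr0 mulr1 mul_scalar_mx.
apply: eq_bigr => k _; rewrite -scalemxAr mulmxA.
by rewrite coef_map /= -mulmxE mul_scalar_mx scalemxAl exprS.
Qed.

End CayleyHamilton.

(** * The law to be proved rigid *)

Lemma mulmx_pencil_comm (F : comNzRingType) k (J D : 'M[F]_k) (a b c d : F) :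
  (a *: J + b *: D) *m (c *: J + d *: D) - (c *: J + d *: D) *m (a *: J + b *: D)
  = (b * c - a * d) *: (D *m J - J *m D).
Proof.
rewrite !(mulmxDl, mulmxDr) -!scalemxAl -!scalemxAr !scalerA.
apply/matrixP => i j; rewrite !mxE; ring.
Qed.

Section Model.
Context (R : realType) (m : nat).
Local Notation C := R[i].
Local Notation n := m.+4.
Implicit Types (c : law R n) (y z a b : 'cV[C]_n).

Definition i0 : 'I_n := @Ordinal n 0 isT.
Definition i1 : 'I_n := @Ordinal n 1 isT.
Definition i2 : 'I_n := @Ordinal n 2 isT.

Definition shift_mx : 'M[C]_n :=
  \matrix_(k, i) ((0 < i)%N && (k == i.+1 :> nat))%:R.

Definition weight_mx : 'M[C]_n :=
  diag_mx (\row_i (if i == 0 :> nat then 1 else i.-1%:R)).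

(** Both x_1 and x_3 act by the shift, with opposite signs. *)
Lemma rmul_algR y :
  rmul (algR R n) y = (y i0 0 - y i2 0) *: shift_mx + y i1 0 *: weight_mx.
Proof.
apply/matrixP => k i; rewrite !mxE !big_ord_recl big1 => [|j _]; last first.
  by rewrite ffunE /algR_product /= mxE mulr0.
rewrite !ffunE /algR_product /= addr0.
have -> : lift ord0 (lift ord0 ord0) = i2 :> 'I_n by apply: val_inj.
have -> : lift ord0 ord0 = i1 by apply: val_inj.
have -> : ord0 = i0 by apply: val_inj.
have kn := ltn_ord k; have := ltn_ord i.
have -> : (n - 1 = m.+3)%N by [].
rewrite [(0 : 'cV[C]_n) k 0]mxE mulr0 addr0 => ltin.
case: i ltin => -[|i] lti /= ltin.
  by rewrite !mxE /= eqSS -(inj_eq val_inj) /=; case: eqP => _ /=; ring.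
rewrite !ltnS in ltin *; rewrite ltin.
have -> : (if (0 < i)%N && true then (i.+2 - 2)%:R *: basis_vec R n i.+2 else 0) k 0
    = i%:R *+ (k == i.+1 :> nat) :> C.
  case: i {lti ltin} => [|i]; rewrite !mxE ?mul0rn //.
  by rewrite eqSS mulr_natr subSS subSS subn0.
have -> : (if k == 0 :> nat then 1 else k.-1%:R) *+ (k == Ordinal lti)
    = i%:R *+ (k == i.+1 :> nat) :> C.
  rewrite (_ : (k == Ordinal lti) = (k == i.+1 :> nat)) //.
  by case: (@eqP _ (k : nat) i.+1) => [->|_]; rewrite ?mulr0n.
case: leqP => [_ | lim]; first by rewrite !mxE eqSS /=; ring.
rewrite !mxE (_ : (k == i.+2 :> nat) = false); first by rewrite /=; ring.
by apply: ltn_eqF; apply: leq_trans kn _.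
Qed.

Lemma weight_shift :
  weight_mx *m shift_mx - shift_mx *m weight_mx = shift_mx.
Proof.
apply/matrixP => k i; rewrite mul_diag_mx mul_mx_diag !mxE.
case: i => -[|i] lti /=; first by ring.
have [->|_] := @eqP _ (k : nat) i.+2; last by rewrite /=; ring.
by rewrite /= -natr1; ring.
Qed.

Lemma shift_mxE y :
  [/\ (shift_mx *m y) i0 0 = 0, (shift_mx *m y) i1 0 = 0 &
      (shift_mx *m y) i2 0 = y i1 0].
Proof.
split; rewrite mxE.
- by rewrite big1 // => j _; rewrite mxE /= andbF mul0r.
- by rewrite big1 // => -[[|j] ltj] _; rewrite mxE /= mul0r.
rewrite (bigD1 i1) //= mxE /= mul1r big1 ?addr0 // => j nj.
rewrite mxE /= eqSS; case: eqP => [j1|_]; last by rewrite andbF mul0r.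
by case/eqP: nj; apply: val_inj.
Qed.

Lemma weight_mxE y :
  [/\ (weight_mx *m y) i0 0 = y i0 0, (weight_mx *m y) i1 0 = 0 &
      (weight_mx *m y) i2 0 = y i2 0].
Proof. by rewrite mul_diag_mx !mxE /= !mul1r mul0r. Qed.

(** In the pencil spanned by J and D every commutator is a multiple of
    D J - J D = J, and the multiple is the one prescribed by the bracket. *)
Lemma Leib_algR : Leib R n (algR R n).
Proof.
apply/LeibP => y z; rewrite [in LHS](rmul_algR (_ *m y)) (rmul_algR z) (rmul_algR y).
rewrite mulmx_pencil_comm weight_shift mulmxDl -!scalemxAl.
have [Jy0 Jy1 Jy2] := shift_mxE y; have [Dy0 Dy1 Dy2] := weight_mxE y.
move: (shift_mx *m y) (weight_mx *m y) Jy0 Jy1 Jy2 Dy0 Dy1 Dy2.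
move=> u v u0 u1 u2 v0 v1 v2; rewrite !mxE u0 u1 u2 v0 v1 v2.
rewrite !mulr0 addr0 scale0r addr0; congr (_ *: _); ring.
Qed.

End Model.

Section ModelBasis.
Context (R : realType) (m : nat).
Local Notation n := m.+4.
Local Notation J := (shift_mx R m).
Local Notation D := (weight_mx R m).
Local Notation x_ := (basis_vec R n).

Lemma rmul_algR1 : rmul (algR R n) (x_ 1) = J.
Proof. by rewrite rmul_algR !mxE /= subr0 scale1r scale0r addr0. Qed.

Lemma rmul_algR2 : rmul (algR R n) (x_ 2) = D.
Proof. by rewrite rmul_algR !mxE /= subr0 scale1r scale0r add0r. Qed.

Lemma shift_basis k : J *m x_ k.+2 = x_ k.+3.
Proof.
case: (ltnP k.+1 n) => kn.
  have -> : x_ k.+2 = delta_mx (Ordinal kn) 0.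
    by apply/colP => i; rewrite !mxE eqxx andbT.
  by rewrite -colE; apply/colP => i; rewrite !mxE.
have x0 l : (n < l)%N -> x_ l = 0.
  by move=> nl; apply/colP => i; rewrite !mxE ltn_eqF // (leq_ltn_trans (ltn_ord i)).
by rewrite !x0 ?mulmx0 ?ltnS // ltnW.
Qed.

Lemma shift_basis1 : J *m x_ 1 = 0.
Proof.
have -> : x_ 1 = delta_mx (i0 m) 0.
  by apply/colP => i; rewrite !mxE eqxx andbT.
by rewrite -colE; apply/colP => i; rewrite !mxE.
Qed.

Lemma weight_basis1 : D *m x_ 1 = x_ 1.
Proof.
apply/colP => i; rewrite mul_diag_mx !mxE eqSS.
by case: eqP => _; rewrite ?mul1r ?mulr0.
Qed.

Lemma weight_basis k : D *m x_ k.+2 = k%:R *: x_ k.+2.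
Proof.
apply/colP => i; rewrite mul_diag_mx !mxE eqSS.
by have [->|_] := @eqP _ (i : nat) k.+1; rewrite ?mulr0.
Qed.

(** The diagonal matrix D has 0 as a simple eigenvalue. *)
Lemma weight_char_coef1 : (char_poly D)`_1 != 0.
Proof.
rewrite char_poly_trig ?diag_mx_is_trig // (bigD1 (i1 m)) //=.
rewrite mxE eqxx mxE /= mulr1n subr0 coefXM /= -horner_coef0 horner_prod.
apply/prodf_neq0 => i ni; rewrite hornerXsubC sub0r oppr_eq0 mxE eqxx mxE mulr1n.
case: i ni => -[|[|i]] lti ni /=; first exact: oner_neq0.
  by case/eqP: ni; apply: val_inj.
by rewrite pnatr_eq0.
Qed.

Lemma shift_exp_basis x k l :
  (x *: J) ^+ k *m x_ l.+2 = x ^+ k *: x_ (l + k).+2.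
Proof.
elim: k => [|k IHk]; first by rewrite expr0 mul1mx scale1r addn0.
rewrite exprS -mulmxE -mulmxA IHk -scalemxAl -scalemxAr shift_basis.
by rewrite scalerA -exprS addnS.
Qed.

Lemma shift_exp_basis1 k x :
  (x *: J) ^+ k *m x_ 1 = (k == 0)%:R *: x_ 1.
Proof.
case: k => [|k]; first by rewrite expr0 mul1mx scale1r.
by rewrite exprSr -mulmxE -mulmxA -scalemxAl shift_basis1 scaler0 mulmx0 scale0r.
Qed.

End ModelBasis.

(** * Recognizing the orbit *)

Section Chain.
Context (R : realType) (m : nat) (c : law R m.+4) (a b : 'cV[R[i]]_m.+4).
Local Notation A := (rmul c a).
Local Notation B := (rmul c b).
Context (lc : Leib R m.+4 c).
Context (BA : B *m A - A *m B = A).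
Context (Bb : B *m b = 0).
Local Notation chain := (chain A b).

(** A b is [b, a], and R_[b, a] = A B - B A. *)
Lemma rmul_chain1 : rmul c (chain 1) = - A.
Proof. by rewrite -chainS chain0 (proj1 (LeibP c) lc) -[X in _ = - X]BA opprB. Qed.

(** R_[A b, a] is the commutator of A with - A, and so on. *)
Lemma rmul_chainSS k : rmul c (chain k.+2) = 0.
Proof.
elim: k => [|k IHk]; rewrite -chainS (proj1 (LeibP c) lc).
  by rewrite rmul_chain1 mulNmx mulmxN opprK addNr.
by rewrite IHk mulmx0 mul0mx subrr.
Qed.

Lemma rmul_comb xi t :
  rmul c (comb A a b xi t) = (xi - t 1%N) *: A + t 0%N *: B.
Proof.
rewrite (@linear_comb _ _ A a b _ (rmul c)); last exact: rmul_chainSS.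
rewrite /= rmul_chain1 scalerN scalerBl -addrA; congr (_ + _); exact: addrC.
Qed.

(** The frame a, b, A b, ... plays the part of x_1, x_2, x_3, ...: its right
    multiplications are those of the model by [rmul_comb], and A and B act on it
    as the shift and as the weights. *)
Lemma orbit_algR_of_chain :
  frame A a b \in unitmx -> A *m a = 0 -> B *m a = a -> chain m.+3 = 0 ->
  Defs.orbit (algR R m.+4) c.
Proof.
set g := frame A a b => gu Aa Ba ch.
have gE j : g *m delta_mx j 0 = if j == 0 :> nat then a else chain j.-1.
  exact: col_frame.
have rE y : rmul c (g *m y) = (y (i0 m) 0 - y (i2 m) 0) *: A + y (i1 m) 0 *: B.
  rewrite frame_mul rmul_comb.
  have -> : inord 1 = i1 m by apply: val_inj; rewrite /= inordK.
  have -> : inord 2 = i2 m by apply: val_inj; rewrite /= inordK.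
  by have -> : i0 m = 0 by apply: val_inj.
have gJ : A *m g = g *m shift_mx R m.
  apply: mulmx_delta_inj => j; rewrite -!mulmxA gE -[shift_mx _ _ *m _]colE.
  case: j => -[|j] ltj /=.
    rewrite Aa (_ : col _ _ = 0) ?mulmx0 //.
    by apply/colP => k; rewrite !mxE.
  rewrite chainS; case: (leqP m.+3 j.+1) => [le3j | lt].
    have jm : j = m.+2 by apply/eqP; rewrite eqn_leq -2!ltnS ltj.
    rewrite [in chain _]jm ch (_ : col _ _ = 0) ?mulmx0 //.
    by apply/colP => k; rewrite !mxE /= [in j.+2]jm (ltn_eqF (ltn_ord k)).
  rewrite (_ : col _ _ = delta_mx (@Ordinal m.+4 j.+2 lt) 0) ?gE //.
  by apply/colP => k; rewrite !mxE andbT.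
have gD : B *m g = g *m weight_mx R m.
  apply: mulmx_delta_inj => j; rewrite -!mulmxA gE.
  have -> : weight_mx R m *m delta_mx j 0 =
      (if j == 0 :> nat then 1 else j.-1%:R) *: delta_mx j 0 :> 'cV_m.+4.
    apply/colP => k; rewrite mul_diag_mx !mxE eqxx andbT.
    by have [->|_] := @eqP _ k j; rewrite ?mulr0.
  rewrite -scalemxAr gE; case: eqP => _; last exact: (weight_chain BA Bb).
  by rewrite Ba scale1r.
exists g; [exact: gu | apply: (act_rmulP gu) => y].
rewrite rE rmul_algR mulmxDl mulmxDr -!scalemxAl -!scalemxAr.
by rewrite gJ gD.
Qed.

Lemma rmul_comb_eq0 xi t : A != 0 ->
  rmul c (comb A a b xi t) = 0 -> t 0%N = 0 /\ t 1%N = xi.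
Proof.
rewrite rmul_comb => A0 /(comm_eq_free BA A0) [/eqP].
by rewrite subr_eq0 => /eqP -> ->.
Qed.

End Chain.

(** [normal_form] changes a by elements x with R_x = 0 only, so the new a still
    has right multiplication A. *)
Lemma orbit_algR_of_null (R : realType) m (c : law R m.+4)
    (a b w : 'cV[R[i]]_m.+4) (A := rmul c a) (B := rmul c b) :
  Leib R m.+4 c -> B *m A - A *m B = A -> B *m b = 0 ->
  frame A a b \in unitmx -> rmul c w = 0 -> A ^+ m.+1 *m w != 0 ->
  (forall t, B *m a <> comb A a b m.+3%:R t) ->
  Defs.orbit (algR R m.+4) c.
Proof.
move=> lc BA Bb fu w0 Aw hs.
have A0 : A != 0.
  by apply: contraNneq Aw => ->; rewrite exprS mul0r mul0mx.
have [||||ch [r [t [r1 [t0 t1] Ba Aa]]]] :=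
  @normal_form _ _ A B a b (fun x => rmul c x = 0) w BA Bb fu _ _ _ _ w0 Aw hs.
- by move=> xi t; apply: rmul_comb_eq0.
- by rewrite linearB /= (proj1 (LeibP c) lc) BA subrr.
- by rewrite (proj1 (LeibP c) lc) subrr.
- exact: rmul_chainSS.
set a' := comb _ _ _ _ _ in Ba Aa.
have Aa' : rmul c a' = A.
  by rewrite rmul_comb // t0 t1 scale0r addr0 opprK subrK scale1r.
have fu' : frame A a' b \in unitmx.
  by apply: frame_comb_unit fu; rewrite subr_eq0 eq_sym.
have := @orbit_algR_of_chain R m c a' b lc; rewrite Aa' => orb.
exact: (orb BA Bb fu' Aa Ba ch).
Qed.

(** * The neighbourhood where laws lie in the orbit *)

Section NearModel.
Context (R : realType) (m : nat).
Local Notation n := m.+4.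
Implicit Types c : law R n.

Local Notation e1 := (basis_vec R m.+4 1).
Local Notation e2 := (basis_vec R m.+4 2).

Definition gen_b c := char_quotient (rmul c e2) e2.
Definition gen_a c := rmul c (gen_b c) *m e1.
(** A symmetrized product, hence in the kernel of the right multiplications. *)
Definition gen_w c := gen_a c + rmul c e1 *m gen_b c.
Definition gen_A c := rmul c (gen_a c).
Definition gen_B c := rmul c (gen_b c).
Definition chain_frame c := frame (gen_A c) (gen_a c) (gen_b c).

(** When this is invertible, the vectors that act by zero have codimension at
    most two. *)
Definition null_frame c : 'M[R[i]]_n :=
  \matrix_(k, j) (if j == 0 :> nat then gen_a c
                  else if j == 1%N :> nat then gen_b c
                  else gen_A c ^+ (j - 2) *m gen_w c) k 0.

(** For a Leibniz law whose two frames are invertible, the last factor is nonzero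
    precisely when the coefficient of a in B a is not m + 3, the weight that
    A^(m + 3) b would have. *)
Definition genericity c : R[i] :=
  \det (chain_frame c) * \det (null_frame c) *
  ((\adj (chain_frame c) *m (gen_B c *m gen_a c)) (i0 m) 0
   - m.+3%:R * (\adj (chain_frame c) *m (gen_B c *m (gen_A c *m gen_b c))) (i2 m) 0).

Section Leibniz.
Context (c : law R n).
Context (lc : Leib R n c).

Let comm y z : rmul c (rmul c z *m y)
    = rmul c z *m rmul c y - rmul c y *m rmul c z.
Proof. exact: (proj1 (LeibP c) lc). Qed.

Lemma rmul_exp_eq0 A' w k : rmul c w = 0 -> rmul c (rmul c A' ^+ k *m w) = 0.
Proof.
move=> w0; elim: k => [|k IHk]; first by rewrite expr0 mul1mx.
by rewrite exprS -mulmxE -mulmxA comm IHk mulmx0 mul0mx subrr.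
Qed.

(** [y, y] acts by zero and R_y preserves the vectors that do, so in
    (chi - chi(0)) / X only the constant term contributes. *)
Lemma rmul_char_quotient y :
  rmul c (char_quotient (rmul c y) y) = (char_poly (rmul c y))`_1 *: rmul c y.
Proof.
rewrite linear_sum big_ord_recl big1 => [|k _].
  by rewrite addr0 linearZ /= expr0 mul1mx.
rewrite linearZ /= exprSr -mulmxE -mulmxA.
by rewrite rmul_exp_eq0 ?scaler0 // comm subrr.
Qed.

(** By Cayley-Hamilton R_y v = - chi(0) y, so R_[v, y] = - chi(0) R_y; but
    R_[v, y] is the commutator of R_y with its multiple R_v, so chi(0) = 0
    unless R_y = 0. *)
Lemma mulmx_rmul_char_quotient y :
  (char_poly (rmul c y))`_1 *: rmul c y != 0 ->
  rmul c (char_quotient (rmul c y) y) *m char_quotient (rmul c y) y = 0.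
Proof.
move=> q0; rewrite rmul_char_quotient -scalemxAl.
have E := comm (char_quotient (rmul c y) y) y.
move/eqP: E; rewrite mulmx_char_quotient rmul_char_quotient.
rewrite -scalemxAl -scalemxAr subrr linearZ /= scaler_eq0 oppr_eq0 => /orP[/eqP ->|/eqP y0].
  by rewrite oppr0 scale0r scaler0.
by rewrite y0 scaler0 eqxx in q0.
Qed.

Lemma orbit_of_genericity : genericity c != 0 -> Defs.orbit (algR R n) c.
Proof.
move=> tc; set a := gen_a c; set v := gen_b c.
have fu : chain_frame c \in unitmx.
  by apply: det_neq0_unitmx; apply: contraNneq tc => d0; rewrite /genericity d0 !mul0r.
have gu : null_frame c \in unitmx.
  by apply: det_neq0_unitmx; apply: contraNneq tc => d0; rewrite /genericity d0 mulr0 mul0r.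
have [a0 ch0] := frame_neq0 fu.
pose A := rmul c a; pose N := rmul c v.
have Nv : N *m v = 0.
  apply: mulmx_rmul_char_quotient; rewrite -rmul_char_quotient.
  by apply: contraNneq a0 => N0; rewrite /gen_a /gen_b N0 mul0mx.
have AE : A = N *m rmul c e1 - rmul c e1 *m N by apply: comm.
have w0 : rmul c (gen_w c) = 0.
  by rewrite linearD /= comm -/N -/A AE addrC subrKA subrr.
pose z := invmx (null_frame c) *m e1.
(* Modulo the vectors that act by zero, x_1 is a combination of a and v. *)
have [x [y E1]] : exists x y, rmul c e1 = x *: A + y *: N.
  rewrite -[e1](mulKVmx gu) -/z.
  rewrite (@linear_mulmx_col2 _ _ _ _ (rmul c)) => [|j j1] /=.
    exists (z ord0 0), (z (lift ord0 ord0) 0).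
    by congr (_ *: rmul c _ + _ *: rmul c _); apply/colP => k; rewrite !mxE.
  rewrite (_ : col j _ = gen_A c ^+ (j - 2) *m gen_w c) ?rmul_exp_eq0 //.
  by apply/colP => k; rewrite 2![LHS]mxE (gtn_eqF (ltnW j1)) (gtn_eqF j1).
have A0 : A != 0.
  apply: contraNneq (ch0 1%N isT) => A0.
  by rewrite -chainS [gen_A c]A0 mul0mx.
(* Bracketing x_1 = x a + y v with v returns a, so x N plays the part of B. *)
have xNA : x *: (N *m A - A *m N) = A.
  by rewrite [in RHS]AE E1 comm_pencil_self.
have x0 : x != 0 by apply: contraNneq A0 => x0; rewrite -xNA x0 scale0r.
have Bx : rmul c (x *: v) = x *: N by rewrite linearZ.
apply: (@orbit_algR_of_null R m c a (x *: v) (gen_w c) lc _ _ _ w0).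
- by rewrite Bx -scalemxAl -scalemxAr -scalerBr xNA.
- by rewrite Bx -scalemxAl -scalemxAr Nv !scaler0.
- exact: (frameZr_unit x0 fu).
- have := unitmx_col_neq0 ord_max gu.
  have -> // : col ord_max (null_frame c) = A ^+ m.+1 *m gen_w c.
  by apply/colP => k; rewrite 2![LHS]mxE.
move=> t; rewrite Bx -scalemxAl => Na.
apply/negP: tc; rewrite negbK; apply/eqP.
rewrite combZr in Na.
have E := adj_frame_weights x0 xNA Nv Na (erefl : i2 m = 2%N :> nat).
have i00 : i0 m = 0 by apply: val_inj.
by rewrite /genericity i00 [X in X - _]E subrr mulr0.
Qed.

End Leibniz.
End NearModel.

Section RegularGenericity.
Context (R : realType) (m : nat).
Local Notation n := m.+4.

Lemma regular_frame p (A : law R n -> 'M[R[i]]_p.+1) a b :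
  regular_mx A -> regular_mx a -> regular_mx b ->
  regular_mx (fun c => frame (A c) (a c) (b c)).
Proof.
move=> rA ra rb k j.
apply: (regular_ext (f := fun c =>
    if j == 0 :> nat then a c k 0 else (A c ^+ j.-1 *m b c) k 0)) => [c|].
  by rewrite [RHS]mxE; case: ifP.
case: eqP => _; first exact: ra.
by apply: regular_mxM => //; apply: regular_mxX.
Qed.

Lemma regular_gen_b : regular_mx (@gen_b R m).
Proof.
have rM : regular_mx (fun c : law R n => rmul c (basis_vec R n 2)).
  by apply: regular_rmul; apply: regular_mx_cst.
apply: regular_mx_sum => k; apply: regular_mxZ; first exact: regular_char_poly.
apply: regular_mxM; last exact: regular_mx_cst.
exact: regular_mxX.
Qed.

Lemma regular_gen_B : regular_mx (@gen_B R m).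
Proof. exact: regular_rmul regular_gen_b. Qed.

Lemma regular_gen_a : regular_mx (@gen_a R m).
Proof. by apply: regular_mxM regular_gen_B _; apply: regular_mx_cst. Qed.

Lemma regular_gen_A : regular_mx (@gen_A R m).
Proof. exact: regular_rmul regular_gen_a. Qed.

Lemma regular_gen_w : regular_mx (@gen_w R m).
Proof.
apply: regular_mxD regular_gen_a _; apply: regular_mxM regular_gen_b.
by apply: regular_rmul; apply: regular_mx_cst.
Qed.

Lemma regular_chain_frame : regular_mx (@chain_frame R m).
Proof. exact: regular_frame regular_gen_A regular_gen_a regular_gen_b. Qed.

Lemma regular_null_frame : regular_mx (@null_frame R m).
Proof.
move=> k j.
apply: (regular_ext (f := fun c =>
    if j == 0 :> nat then gen_a c k 0 else if j == 1%N :> nat then gen_b c k 0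
    else (gen_A c ^+ (j - 2) *m gen_w c) k 0)) => [c|].
  by rewrite [RHS]mxE; case: ifP => // _; case: ifP.
case: eqP => _; first exact: regular_gen_a.
case: eqP => _; first exact: regular_gen_b.
apply: (regular_mxM _ regular_gen_w); apply: regular_mxX; exact: regular_gen_A.
Qed.

Lemma regular_genericity : regular (@genericity R m).
Proof.
have rF := regular_adj regular_chain_frame.
apply: regularM.
  by apply: regularM; apply: regular_det;
    [apply: regular_chain_frame | apply: regular_null_frame].
apply: regularD.
  exact: (regular_mxM rF (regular_mxM regular_gen_B regular_gen_a)).
apply: regularN; apply: regularM; first exact: regular_cst.
exact: (regular_mxM rF (regular_mxM regular_gen_B
  (regular_mxM regular_gen_A regular_gen_b))).
Qed.

End RegularGenericity.

Section GenericityModel.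
Context (R : realType) (m : nat).
Local Notation n := m.+4.
Local Notation J := (shift_mx R m).
Local Notation D := (weight_mx R m).
Local Notation x_ := (basis_vec R n).

Local Notation q := ((char_poly D)`_1).

Lemma gen_b_algR : gen_b (algR R n) = q *: x_ 2.
Proof.
rewrite /gen_b rmul_algR2 /char_quotient big_ord_recl big1 => [|k _].
  by rewrite addr0 expr0 mul1mx.
by rewrite exprSr -mulmxE -mulmxA weight_basis scale0r mulmx0 scaler0.
Qed.

Lemma gen_B_algR : gen_B (algR R n) = q *: D.
Proof. by rewrite /gen_B gen_b_algR linearZ /= rmul_algR2. Qed.

Lemma gen_a_algR : gen_a (algR R n) = q *: x_ 1.
Proof. by rewrite /gen_a -/(gen_B _) gen_B_algR -scalemxAl weight_basis1. Qed.

Lemma gen_A_algR : gen_A (algR R n) = q *: J.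
Proof. by rewrite /gen_A gen_a_algR linearZ /= rmul_algR1. Qed.

Lemma gen_w_algR : gen_w (algR R n) = q *: x_ 1 + q *: x_ 3.
Proof.
by rewrite /gen_w gen_a_algR rmul_algR1 gen_b_algR -scalemxAr shift_basis.
Qed.

(** At the model the frame consists of multiples of the basis vectors. *)
Lemma chain_frame_algR :
  chain_frame (algR R n) = diag_mx (\row_j q ^+ maxn 1 j).
Proof.
apply/matrixP => k j; rewrite /chain_frame gen_A_algR gen_a_algR gen_b_algR.
rewrite [RHS]mxE [X in _ = X *+ _]mxE [LHS]mxE.
case: j => -[|j] ltj /=.
  rewrite !mxE eqSS (_ : (k == Ordinal ltj) = (k == 0 :> nat)) //.
  by have [->|_] := @eqP _ (k : nat) 0%N; rewrite ?mulr1 ?mulr0.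
rewrite chainZ /chain shift_exp_basis scalerA -exprS add0n !mxE eqSS.
rewrite (_ : (k == Ordinal ltj) = (k == j.+1 :> nat)) //.
by have [->|_] := @eqP _ (k : nat) j.+1; rewrite ?mulr1 ?mulr0 // maxnSS max0n.
Qed.

(** The vector gen_w is a multiple of x_1 + x_3 here; it is the only column off
    the diagonal. *)
Lemma null_frame_algR_trig : is_trig_mx (null_frame (algR R n))^T.
Proof.
apply/is_trig_mxP => j k jk; rewrite 2!mxE; move: k jk.
rewrite gen_a_algR gen_b_algR gen_A_algR gen_w_algR.
case: j => -[|[|j]] ltj k /= jk.
- by rewrite !mxE eqSS gtn_eqF ?mulr0.
- by rewrite !mxE eqSS gtn_eqF ?mulr0.
rewrite subSS subSS subn0 mulmxDr -!scalemxAr shift_exp_basis shift_exp_basis1.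
have k0 : (k == 0 :> nat) = false by apply: gtn_eqF; apply: leq_ltn_trans jk.
by rewrite !mxE !eqSS add1n k0 (gtn_eqF jk) !mulr0 addr0.
Qed.

Lemma null_frame_algR_diag (j : 'I_n) : null_frame (algR R n) j j != 0.
Proof.
have q0 k : q ^+ k != 0 by rewrite expf_neq0 // weight_char_coef1.
rewrite mxE gen_a_algR gen_b_algR gen_A_algR gen_w_algR.
case: j => -[|[|j]] ltj /=.
- by rewrite !mxE mulr1 (q0 1%N).
- by rewrite !mxE mulr1 (q0 1%N).
rewrite subSS subSS subn0 mulmxDr -!scalemxAr shift_exp_basis shift_exp_basis1.
by rewrite add1n !mxE eqxx /= !mulr0 add0r mulr1 mulf_neq0 // (q0 1%N).
Qed.

Lemma genericity_algR : genericity (algR R n) != 0.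
Proof.
have q0 := weight_char_coef1 R m.
have dF : \det (chain_frame (algR R n)) != 0.
  rewrite chain_frame_algR det_diag; apply/prodf_neq0 => j _.
  by rewrite mxE expf_neq0.
have dG : \det (null_frame (algR R n)) != 0.
  rewrite -det_tr (det_trig null_frame_algR_trig); apply/prodf_neq0 => j _.
  by rewrite mxE null_frame_algR_diag.
apply: (mulf_neq0 (mulf_neq0 dF dG)).
have i00 : i0 m = 0 by apply: val_inj.
rewrite i00 (adj_frame_diff (x := q)) //.
- apply: mulf_neq0 (mulf_neq0 q0 dF).
  by rewrite subr_eq0 eq_sym pnatr_eq1.
- by rewrite gen_B_algR gen_a_algR -scalemxAl -scalemxAr weight_basis1.
rewrite gen_A_algR gen_b_algR gen_B_algR -!(scalemxAl, scalemxAr).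
by rewrite shift_basis weight_basis mulr1n scale1r.
Qed.

End GenericityModel.

Theorem corollary3p10 (R : realType) (n : nat) (hn : (4 <= n)%N) :
  rigid (algR R n).
Proof.
case: n hn => [|[|[|[|m]]]] // _.
apply: (rigid_of_regular (@Leib_algR R m) (@regular_genericity R m) (@genericity_algR R m)).
by move=> c lc; apply: orbit_of_genericity.
Qed.
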